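(* Let $\mathcal{E}: 0 \to A \to L \to B \to 0$ be an abelian extension of Lie algebras over a field $F$, and let $\alpha: B \to \mathrm{End}(A)$ denote the induced $B$-module structure on $A$. Then there is an exact sequence $$0 \to Z^1(B;A) \xrightarrow{\ i\ } \mathrm{Aut}_A(L) \xrightarrow{\ \tau\ } C_\alpha \xrightarrow{\ \omega_{\mathcal{E}}\ } H^2(B;A),$$ where exactness at $C_\alpha$ means that the image of $\tau$ equals $\{(\theta,\phi)\in C_\alpha : \omega_{\mathcal E}(\theta,\phi)=0\}$.
   Context: All Lie algebras are over a field $F$. An extension of $B$ by $A$ is a short exact sequence of Lie algebras $0 \to A \to L \xrightarrow{p} B \to 0$; it is abelian if $A$ is an abelian Lie algebra. We regard $A$ as an ideal of $L$. A section is an $F$-linear map $s: B\to L$ with $p s = 1_B$. For an abelian extension, $A$ is a left $B$-module via $ba = [s(b),a]$ (independent of $s$); the corresponding Lie algebra homomorphism is $\alpha: B \to \mathrm{End}(A)$, where $\mathrm{End}(A)$ is the Lie algebra of $F$-linear endomorphisms of $A$ with the commutator bracket. Put $\mu(b_1,b_2)=[s(b_1),s(b_2)]-s([b_1,b_2])\in A$; this is a 2-cocycle. $Z^k(B;A)$, $B^k(B;A)$ and $H^k(B;A)=Z^k(B;A)/B^k(B;A)$ are the cocycles, coboundaries and cohomology of the Chevalley–Eilenberg complex $C^k(B;A)=\mathrm{Hom}_F(\Lambda^k B, A)$. In particular $Z^1(B;A)$ is the additive group of $F$-linear maps $\lambda: B\to A$ with $\lambda([b_0,b_1]) = b_0\lambda(b_1)-b_1\lambda(b_0)$,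 and $(\partial^1\lambda)(b_1,b_2)=b_1\lambda(b_2)-b_2\lambda(b_1)-\lambda([b_1,b_2])$. $\mathrm{Aut}(\cdot)$ denotes the group of Lie algebra automorphisms, and $\mathrm{Aut}_A(L)$ the group of Lie algebra automorphisms $\gamma$ of $L$ with $\gamma(A)=A$. The map $\tau$ is the group homomorphism $\tau(\gamma) = (\gamma|_A, \overline{\gamma})\in \mathrm{Aut}(A)\times \mathrm{Aut}(B)$, with $\overline{\gamma}(b) = p(\gamma(s(b)))$. $C_\alpha$ is the subgroup of $\mathrm{Aut}(A)\times\mathrm{Aut}(B)$ of compatible pairs, i.e. pairs $(\theta,\phi)$ with $\alpha(\phi(b))=\theta\alpha(b)\theta^{-1}$ for all $b\in B$; the image of $\tau$ lies in $C_\alpha$. The map $i$ is the group homomorphism sending $\lambda\in Z^1(B;A)$ to the automorphism $\gamma_\lambda$ of $L$ given by $\gamma_\lambda(a+s(b))=a+\lambda(b)+s(b)$ for $a\in A$, $b\in B$. The map of sets $\omega_{\mathcal{E}}: C_\alpha \to H^2(B;A)$ is $\omega_{\mathcal{E}}(\theta,\phi)=[\mu_{\theta,\phi}]$, the cohomology class of the 2-cocycle $\mu_{\theta,\phi}(b_1,b_2)=\theta\big(\mu(\phi^{-1}(b_1),\phi^{-1}(b_2))\big)-\mu(b_1,b_2)$. *)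

(* Defs.v *)
From HB Require Import structures.
From mathcomp Require Import all_boot ssralg ring_quotient.
From mathcomp Require Import mathcomp_extra boolp classical_sets functions.

Set Implicit Arguments.
Unset Strict Implicit.
Unset Printing Implicit Defensive.

Import GRing.Theory.
Local Open Scope classical_set_scope.
Local Open Scope ring_scope.

Reserved Notation "{[ x , y ]}" (at level 0, x, y at level 99,
  format "{[ x ,  y ]}").
Reserved Notation "{ 'lie' L -> M }" (at level 0, L at level 98, M at level 99,
  format "{ 'lie'  L  ->  M }").

HB.mixin Record Lmodule_isLieAlgebra (F : fieldType) L of GRing.Lmodule F L := {
  bracket : L -> L -> L;
  bracket_linearl : forall y, linear (bracket^~ y);
  bracket_linearr : forall x, linear (bracket x);
  bracketxx : forall x, bracket x x = 0;
  bracket_jacobi : forall x y z,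
    bracket x (bracket y z) + bracket y (bracket z x)
      + bracket z (bracket x y) = 0
}.

#[short(type="lieAlgType")]
HB.structure Definition LieAlgebra (F : fieldType) :=
  {L of GRing.Lmodule F L & Lmodule_isLieAlgebra F L}.

Notation "{[ x , y ]}" := (bracket x y) : ring_scope.

HB.mixin Record isLieMorphism (F : fieldType) (L M : lieAlgType F)
    (f : L -> M) := {
  lie_morphM : {morph f : x y / {[x, y]} >-> {[x, y]}}
}.

HB.structure Definition LieMorphism (F : fieldType) (L M : lieAlgType F) :=
  {f of @GRing.Linear F L M *:%R f & isLieMorphism F L M f}.

Notation "{ 'lie' L -> M }" := (LieMorphism.type L M) : type_scope.

Section BracketTheory.
Variables (F : fieldType) (L : lieAlgType F).
Implicit Types (x y z : L) (k : F).

Lemma bracketDl x y z : {[x + y, z]} = {[x, z]} + {[y, z]}.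
Proof. by have := bracket_linearl z 1 x y; rewrite !scale1r. Qed.

Lemma bracketDr x y z : {[x, y + z]} = {[x, y]} + {[x, z]}.
Proof. by have := bracket_linearr x 1 y z; rewrite !scale1r. Qed.

Lemma bracket0l x : {[0, x]} = 0 :> L.
Proof. by apply: (addrI {[0, x]}); rewrite -bracketDl !addr0. Qed.

Lemma bracket0r x : {[x, 0]} = 0 :> L.
Proof. by apply: (addrI {[x, 0]}); rewrite -bracketDr !addr0. Qed.

Lemma bracketZl k x y : {[k *: x, y]} = k *: {[x, y]}.
Proof. by have := bracket_linearl y k x 0; rewrite !addr0 bracket0l addr0. Qed.

Lemma bracketZr k x y : {[x, k *: y]} = k *: {[x, y]}.
Proof. by have := bracket_linearr x k y 0; rewrite !addr0 bracket0r addr0. Qed.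

Lemma bracketNl x y : {[- x, y]} = - {[x, y]}.
Proof. by rewrite -scaleN1r bracketZl scaleN1r. Qed.

Lemma bracketNr x y : {[x, - y]} = - {[x, y]}.
Proof. by rewrite -scaleN1r bracketZr scaleN1r. Qed.

Lemma bracketBl x y z : {[x - y, z]} = {[x, z]} - {[y, z]}.
Proof. by rewrite bracketDl bracketNl. Qed.

Lemma bracketBr x y z : {[x, y - z]} = {[x, y]} - {[x, z]}.
Proof. by rewrite bracketDr bracketNr. Qed.

Lemma bracketC x y : {[x, y]} = - {[y, x]}.
Proof.
have := bracketxx (x + y); rewrite bracketDl !bracketDr !bracketxx add0r addr0.
by move/eqP; rewrite addr_eq0 => /eqP.
Qed.

Lemma bracketA x y z : {[{[x, y]}, z]} = {[x, {[y, z]}]} - {[y, {[x, z]}]}.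
Proof.
have /eqP := bracket_jacobi x y z; rewrite addrC addr_eq0 => /eqP e.
by rewrite bracketC e opprK [{[z, x]}]bracketC bracketNr.
Qed.

Lemma bracket_jacobil x y z :
  {[{[x, y]}, z]} = {[{[x, z]}, y]} - {[{[y, z]}, x]}.
Proof.
rewrite bracketA [{[{[x, z]}, y]}]bracketC [{[{[y, z]}, x]}]bracketC opprK.
by rewrite addrC.
Qed.

Lemma bracket_jacobir x y z :
  {[x, {[y, z]}]} = {[y, {[x, z]}]} - {[z, {[x, y]}]}.
Proof. by rewrite [{[z, _]}]bracketC opprK bracketA addrC subrK. Qed.

End BracketTheory.

Section LieAut.
Variables (F : fieldType) (L : lieAlgType F).

Definition is_lieAut (f : L -> L) : Prop :=
  [/\ linear f, {morph f : x y / {[x, y]}} & bijective f].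

Record lieAut := LieAut { lieAut_fun :> L -> L; _ : `[< is_lieAut lieAut_fun >] }.

HB.instance Definition _ := [isSub for lieAut_fun].
HB.instance Definition _ := [Choice of lieAut by <:].

Implicit Types f g h : lieAut.

Lemma lieAutP f : is_lieAut f.
Proof. by case: f => f /= /asboolP. Qed.

Lemma lieAut_ext f g : (forall x, f x = g x) -> f = g.
Proof. by move=> fg; apply/val_inj/funext. Qed.

HB.instance Definition _ f :=
  GRing.isLinear.Build F L L *:%R f (let: And3 l _ _ := lieAutP f in l).
HB.instance Definition _ f :=
  isLieMorphism.Build F L L f (let: And3 _ m _ := lieAutP f in m).

Lemma lieAut1_subproof : `[< is_lieAut id >].
Proof. by apply/asboolP; split=> //; exists id. Qed.

Lemma lieAutM_subproof f g : `[< is_lieAut (f \o g) >].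
Proof.
apply/asboolP; split=> [k x y|x y|] /=.
- by rewrite !linearP.
- by rewrite !lie_morphM.
- by apply: bij_comp; [case: (lieAutP f)|case: (lieAutP g)].
Qed.

Lemma lieAut_inv_exists f : exists g : L -> L, cancel f g /\ cancel g f.
Proof. by have [_ _ [g]] := lieAutP f; exists g. Qed.

Definition lieAut_inv f : L -> L := sval (cid (lieAut_inv_exists f)).

Lemma lieAut_invK f : cancel f (lieAut_inv f).
Proof. by rewrite /lieAut_inv; case: cid => g []. Qed.

Lemma lieAut_invVK f : cancel (lieAut_inv f) f.
Proof. by rewrite /lieAut_inv; case: cid => g []. Qed.

Lemma lieAutV_subproof f : `[< is_lieAut (lieAut_inv f) >].
Proof.
have [fK Kf] := (lieAut_invK f, lieAut_invVK f).
apply/asboolP; split=> [k x y|x y|]; last by exists f.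
- by apply: (can_inj fK); rewrite Kf linearP /= !Kf.
- by apply: (can_inj fK); rewrite Kf lie_morphM /= !Kf.
Qed.

Definition lieAut1 := LieAut lieAut1_subproof.
Definition lieAutM f g := LieAut (lieAutM_subproof f g).
Definition lieAutV f := LieAut (lieAutV_subproof f).

Lemma lieAutMA : associative lieAutM.
Proof. by move=> f g h; apply: lieAut_ext => x. Qed.
Lemma lieAutM1 : right_id lieAut1 lieAutM.
Proof. by move=> f; apply: lieAut_ext => x. Qed.
Lemma lieAut1M : left_id lieAut1 lieAutM.
Proof. by move=> f; apply: lieAut_ext => x. Qed.
Lemma lieAutVM : left_inverse lieAut1 lieAutV lieAutM.
Proof. by move=> f; apply: lieAut_ext => x /=; rewrite lieAut_invK. Qed.
Lemma lieAutMV : right_inverse lieAut1 lieAutV lieAutM.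
Proof. by move=> f; apply: lieAut_ext => x /=; rewrite lieAut_invVK. Qed.

HB.instance Definition _ :=
  isGroup.Build lieAut lieAutMA lieAut1M lieAutM1 lieAutVM lieAutMV.

Lemma lieAut1E x : (1%g : lieAut) x = x.
Proof. by []. Qed.
Lemma lieAutME f g x : (f * g)%g x = f (g x).
Proof. by []. Qed.
Lemma lieAutK f : cancel f (f^-1)%g.
Proof. exact: lieAut_invK. Qed.
Lemma lieAutVK f : cancel (f^-1)%g f.
Proof. exact: lieAut_invVK. Qed.

End LieAut.

Section LieEnd.
Variables (F : fieldType) (A : lmodType F).

Definition linear_pred : {pred A -> A} := fun f => `[< linear f >].

Lemma linear_predP (f : A -> A) : reflect (linear f) (f \in linear_pred).
Proof. exact: asboolP. Qed.

Lemma linear_pred_closed : submod_closed linear_pred.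
Proof.
split=> [|c f g /linear_predP lf /linear_predP lg]; apply/linear_predP => k x y.
  by rewrite /= scaler0 addr0.
change (c *: f (k *: x + y) + g (k *: x + y)
  = k *: (c *: f x + g x) + (c *: f y + g y)).
by rewrite lf lg !scalerDr !scalerA [c * k]mulrC addrACA.
Qed.

HB.instance Definition _ :=
  GRing.isSubmodClosed.Build F (A -> A) linear_pred linear_pred_closed.

Record lieEnd := LieEnd { lieEnd_fun :> A -> A; _ : lieEnd_fun \in linear_pred }.

HB.instance Definition _ := [isSub for lieEnd_fun].
HB.instance Definition _ := [Choice of lieEnd by <:].
HB.instance Definition _ := [SubChoice_isSubZmodule of lieEnd by <:].
HB.instance Definition _ := [SubZmodule_isSubLmodule of lieEnd by <:].

Implicit Types f g h : lieEnd.

Lemma lieEndP f : linear f.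
Proof. by case: f => f /= /linear_predP. Qed.

HB.instance Definition _ f := GRing.isLinear.Build F A A *:%R f (lieEndP f).

Lemma lieEnd_ext f g : (forall x, f x = g x) -> f = g.
Proof. by move=> fg; apply/val_inj/funext. Qed.

Lemma lieEnd0E x : (0 : lieEnd) x = 0. Proof. by []. Qed.
Lemma lieEndDE f g x : (f + g) x = f x + g x. Proof. by []. Qed.
Lemma lieEndNE f x : (- f) x = - f x. Proof. by []. Qed.
Lemma lieEndZE k f x : (k *: f) x = k *: f x. Proof. by []. Qed.

Lemma commutator_subproof f g :
  (fun x => f (g x) - g (f x)) \in linear_pred.
Proof.
apply/linear_predP => k x y /=.
by rewrite (linearP g) (linearP f) /= (linearP f) (linearP g) /= opprD addrACA
  scalerBr.
Qed.

Definition commutator f g := LieEnd (commutator_subproof f g).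

Lemma commutatorE f g x : commutator f g x = f (g x) - g (f x).
Proof. by []. Qed.

Lemma commutator_linearl g : linear (commutator^~ g).
Proof.
move=> k f h; apply: lieEnd_ext => x.
rewrite !(lieEndDE, lieEndZE, commutatorE).
by rewrite (linearP g) /= opprD addrACA scalerBr.
Qed.

Lemma commutator_linearr f : linear (commutator f).
Proof.
move=> k g h; apply: lieEnd_ext => x.
rewrite !(lieEndDE, lieEndZE, commutatorE).
by rewrite (linearP f) /= opprD addrACA scalerBr.
Qed.

Lemma commutatorxx f : commutator f f = 0.
Proof. by apply: lieEnd_ext => x /=; rewrite subrr. Qed.

Lemma commutator_jacobi f g h :
  commutator f (commutator g h) + commutator g (commutator h f)
    + commutator h (commutator f g) = 0.
Proof.
apply: lieEnd_ext => x; rewrite !(lieEndDE, commutatorE) lieEnd0E.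
rewrite (raddfB f) (raddfB g) (raddfB h) /= !opprB !addrA.
rewrite (ACl ((1 * 12) * (7 * 2) * (3 * 10) * (5 * 4) * (11 * 6) * (9 * 8)))%AC.
by rewrite /= !subrr !addr0.
Qed.

HB.instance Definition _ := Lmodule_isLieAlgebra.Build F lieEnd
  commutator_linearl commutator_linearr commutatorxx commutator_jacobi.

Lemma lieEnd_bracketE f g x : {[f, g]} x = f (g x) - g (f x).
Proof. by []. Qed.

End LieEnd.

(* The Chevalley-Eilenberg complex is only needed in low degrees, with
   [Hom(Lambda^2 B, A)] rendered as the space of alternating bilinear maps;
   [d1] and [d2] below spell out its differential
   [(d f)(b_0, .., b_k) = sum_i (-1)^i b_i f(.., ^b_i, ..)
     + sum_(i < j) (-1)^(i+j) f({[b_i, b_j]}, .., ^b_i, .., ^b_j, ..)]. *)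

Section Cohomology.
Variables (F : fieldType) (B : lieAlgType F) (A : lmodType F).
Variable rho : {lie B -> lieEnd A}.
Implicit Types (l : B -> A) (f : B -> B -> A).

Lemma moduleM b c a :
  rho {[b, c]} a = rho b (rho c a) - rho c (rho b a).
Proof. by rewrite lie_morphM. Qed.

Lemma moduleP k b c a : rho (k *: b + c) a = k *: rho b a + rho c a.
Proof. by rewrite (linearP rho). Qed.

Definition is_cochain2 f : Prop :=
  [/\ forall y, linear (f^~ y), forall x, linear (f x) & forall x, f x x = 0].

Definition d1 l : B -> B -> A := fun b1 b2 =>
  rho b1 (l b2) - rho b2 (l b1) - l {[b1, b2]}.

Definition d2 f (b1 b2 b3 : B) : A :=
  rho b1 (f b2 b3) - rho b2 (f b1 b3) + rho b3 (f b1 b2)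
  - f {[b1, b2]} b3 + f {[b1, b3]} b2 - f {[b2, b3]} b1.

Definition cocycle1 : {pred B -> A} := fun l => `[< linear l /\
  forall b0 b1, l {[b0, b1]} = rho b0 (l b1) - rho b1 (l b0) >].

Definition cocycle2 : {pred B -> B -> A} := fun f => `[< is_cochain2 f /\
  forall b1 b2 b3, d2 f b1 b2 b3 = 0 >].

Lemma cocycle1_closed : zmod_closed cocycle1.
Proof.
split=> [|l m /asboolP[ll lc] /asboolP[ml mc]]; apply/asboolP; split.
- by move=> k x y /=; rewrite scaler0 addr0.
- move=> x y; change (0 = rho x 0 - rho y 0 :> A).
  by rewrite !raddf0 addr0.
- move=> k x y; change (l (k *: x + y) - m (k *: x + y)
    = k *: (l x - m x) + (l y - m y)).
  by rewrite ll ml opprD addrACA scalerBr.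
- move=> x y; change (l {[x, y]} - m {[x, y]}
    = rho x (l y - m y) - rho y (l x - m x)).
  rewrite lc mc (raddfB (rho x)) (raddfB (rho y)) /= !opprB !addrA.
  by rewrite [LHS](ACl (1 * 4 * 3 * 2))%AC.
Qed.

HB.instance Definition _ :=
  GRing.isZmodClosed.Build (B -> A) cocycle1 cocycle1_closed.

Lemma d2B f g b1 b2 b3 : d2 (f - g) b1 b2 b3 = d2 f b1 b2 b3 - d2 g b1 b2 b3.
Proof.
have E x y : (f - g) x y = f x y - g x y by [].
rewrite /d2 !E (raddfB (rho b1)) (raddfB (rho b2)) (raddfB (rho b3)) /=.
rewrite !opprD !opprK !addrA.
by rewrite [LHS](ACl (1 * 3 * 5 * 7 * 9 * 11 * 2 * 4 * 6 * 8 * 10 * 12))%AC.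
Qed.

Lemma cocycle2_closed : zmod_closed cocycle2.
Proof.
split=> [|f g /asboolP[[fl fr fx] fc] /asboolP[[gl gr gx] gc]];
  apply/asboolP; split; first split.
- by move=> y k x z /=; rewrite scaler0 addr0.
- by move=> y k x z /=; rewrite scaler0 addr0.
- by [].
- move=> x y z.
  change (rho x 0 - rho y 0 + rho z 0 - 0 + 0 - 0 = 0 :> A).
  by rewrite !raddf0 !addr0.
- have E x y : (f - g) x y = f x y - g x y by [].
  split=> [y k x z|y k x z|x]; rewrite !E.
  + by rewrite fl gl opprD addrACA scalerBr.
  + by rewrite fr gr opprD addrACA scalerBr.
  + by rewrite fx gx subr0.
- by move=> x y z; rewrite d2B fc gc subr0.
Qed.

HB.instance Definition _ :=
  GRing.isZmodClosed.Build (B -> B -> A) cocycle2 cocycle2_closed.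

Record Z1 := MkZ1 { Z1_fun :> B -> A; _ : Z1_fun \in cocycle1 }.
HB.instance Definition _ := [isSub for Z1_fun].
HB.instance Definition _ := [Choice of Z1 by <:].
HB.instance Definition _ := [SubChoice_isSubZmodule of Z1 by <:].

Record Z2 := MkZ2 { Z2_fun :> B -> B -> A; _ : Z2_fun \in cocycle2 }.
HB.instance Definition _ := [isSub for Z2_fun].
HB.instance Definition _ := [Choice of Z2 by <:].
HB.instance Definition _ := [SubChoice_isSubZmodule of Z2 by <:].

Lemma Z1P (l : Z1) : linear l /\
  forall b0 b1, l {[b0, b1]} = rho b0 (l b1) - rho b1 (l b0).
Proof. by case: l => l /= /asboolP. Qed.

HB.instance Definition _ (l : Z1) :=
  GRing.isLinear.Build F B A *:%R l (proj1 (Z1P l)).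

Lemma Z2P (f : Z2) : is_cochain2 f /\ forall b1 b2 b3, d2 f b1 b2 b3 = 0.
Proof. by case: f => f /= /asboolP. Qed.

Lemma Z1_ext (l m : Z1) : (forall x, l x = m x) -> l = m.
Proof. by move=> lm; apply/val_inj/funext. Qed.

Lemma Z1DE (l m : Z1) x : (l + m) x = l x + m x. Proof. by []. Qed.
Lemma Z1NE (l : Z1) x : (- l) x = - l x. Proof. by []. Qed.
Lemma Z1_0E x : (0 : Z1) x = 0. Proof. by []. Qed.

Lemma d1_cocycle (l : {linear B -> A}) : d1 l \in cocycle2.
Proof.
apply/asboolP; split; first split.
- move=> y k x z; rewrite /d1 bracketDl bracketZl !(linearP l) moduleP.
  rewrite (linearP (rho y)) /=.
  rewrite !scalerBr !opprD !addrA.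
  by rewrite [LHS](ACl (1 * 3 * 5 * 2 * 4 * 6))%AC.
- move=> x k y z; rewrite /d1 bracketDr bracketZr !(linearP l) moduleP.
  rewrite (linearP (rho x)) /=.
  rewrite !scalerBr !opprD !addrA.
  by rewrite [LHS](ACl (1 * 3 * 5 * 2 * 4 * 6))%AC.
- by move=> x; rewrite /d1 bracketxx linear0 subrr subr0.
- move=> x y z; rewrite /d2 /d1 !moduleM.
  rewrite !(raddfB (rho x), raddfB (rho y), raddfB (rho z)) /=.
  have -> : l {[{[x, y]}, z]} = l {[{[x, z]}, y]} - l {[{[y, z]}, x]}.
    by rewrite -(raddfB l) /= -bracket_jacobil.
  rewrite !opprB !addrA.
  rewrite [LHS](ACl ((1 * 14) * (15 * 2) * (20 * 3) * (4 * 17) * (5 * 22)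
    * (13 * 6) * (7 * 16) * (21 * 8) * (12 * 9) * (10 * 18) * (19 * 11)))%AC.
  by rewrite /= !subrr !addr0.
Qed.

Definition coboundary2 : {pred Z2} := fun f : Z2 =>
  `[< exists l : {linear B -> A}, (f : B -> B -> A) = d1 l >].

Lemma coboundary2_closed : zmod_closed coboundary2.
Proof.
split=> [|f g /asboolP[l fl] /asboolP[m gm]]; apply/asboolP.
  exists \0; apply/funext => x; apply/funext => y.
  by rewrite /d1 /= !raddf0 !addr0.
exists (l \- m); apply/funext => x; apply/funext => y.
change (f x y - g x y = d1 (l \- m) x y); rewrite fl gm /d1 /=.
rewrite (raddfB (rho x)) (raddfB (rho y)) /= !opprD !opprK !addrA.
by rewrite [LHS](ACl (1 * 4 * 2 * 5 * 3 * 6))%AC.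
Qed.

HB.instance Definition _ :=
  GRing.isZmodClosed.Build Z2 coboundary2 coboundary2_closed.

Definition H2 := Quotient.quot coboundary2.
HB.instance Definition _ := GRing.Zmodule.on H2.

Definition class2 (f : Z2) : H2 := (\pi_(Quotient.quot coboundary2) f)%qT.

Lemma class2_eq (f g : Z2) : class2 f = class2 g <-> f - g \in coboundary2.
Proof.
by rewrite Quotient.idealrBE; split=> [e|/eqP//]; apply/eqP.
Qed.

Lemma class2_eq0 (f : Z2) : class2 f = 0 <-> f \in coboundary2.
Proof. 
rewrite -[f in f \in _]subr0 -class2_eq.
suff -> : class2 0 = 0 by [].
exact: (@pi_zeror _ _ _ _ _ (Quotient.quot coboundary2)).
Qed.

End Cohomology.

Definition abelian_lie (F : fieldType) (A : lieAlgType F) : Prop :=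
  forall a b : A, {[a, b]} = 0.

Record extension (F : fieldType) (A L B : lieAlgType F) := Extension {
  ext_incl : {lie A -> L};
  ext_proj : {lie L -> B};
  ext_incl_inj : injective ext_incl;
  ext_proj_surj : forall b, exists x, ext_proj x = b;
  ext_exact : range ext_incl = [set x | ext_proj x = 0]
}.

Record abelian_extension (F : fieldType) (A L B : lieAlgType F) :=
  AbelianExtension {
    abelian_ext :> extension A L B;
    abelian_ext_ker : abelian_lie A
  }.

Record lin_section (F : fieldType) (A L B : lieAlgType F)
    (E : extension A L B) := LinSection {
  lin_section_fun :> {linear B -> L};
  lin_sectionK : cancel lin_section_fun (ext_proj E)
}.

Section Extension.
Variables (F : fieldType) (A L B : lieAlgType F) (E : extension A L B).
Local Notation iota := (ext_incl E).
Local Notation p := (ext_proj E).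

(* [ext_pre x] is the preimage of [x] in [A]; it is only meaningful on the
   kernel of the projection (junk value 0 outside), see [ext_preK]. *)
Definition ext_pre (x : L) : A := xget 0 [set a | iota a = x].

Lemma ext_proj_incl a : p (iota a) = 0.
Proof.
have : range iota (iota a) by exists a.
by rewrite ext_exact.
Qed.

Lemma ext_preK x : p x = 0 -> iota (ext_pre x) = x.
Proof.
move=> px; have : range iota x by rewrite ext_exact.
by case=> a _ ax; exact: (xgetI (P := [set a | iota a = x]) 0 ax).
Qed.

Lemma ext_inclK : cancel iota ext_pre.
Proof. by move=> a; apply/(ext_incl_inj (e := E))/ext_preK/ext_proj_incl. Qed.

End Extension.

Section AbelianExtension.
Variables (F : fieldType) (A L B : lieAlgType F) (E : abelian_extension A L B).
Variable s : lin_section E.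
Local Notation iota := (ext_incl E).
Local Notation p := (ext_proj E).

Let iota_inj : injective iota := ext_incl_inj (e := E).
Let psK : cancel s p := lin_sectionK s.

Lemma proj_bracket_incl x a : p {[x, iota a]} = 0.
Proof. by rewrite lie_morphM ext_proj_incl bracket0r. Qed.

Lemma action_subproof b :
  (fun a => ext_pre E {[s b, iota a]}) \in linear_pred (A := A).
Proof.
apply/linear_predP => k x y; apply: iota_inj.
rewrite ext_preK ?proj_bracket_incl // !linearP /=.
by rewrite !ext_preK ?proj_bracket_incl // bracketDr bracketZr.
Qed.

Definition action b : lieEnd A := LieEnd (action_subproof b).

Lemma incl_action b a : iota (action b a) = {[s b, iota a]}.
Proof. by rewrite ext_preK ?proj_bracket_incl. Qed.

Lemma decomp x : x = iota (ext_pre E (x - s (p x))) + s (p x).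
Proof. by rewrite ext_preK ?subrK // linearB /= psK subrr. Qed.

(* As [A] is abelian, the action of [b] can be computed from any lift of [b]. *)
Lemma bracket_incl x a : {[x, iota a]} = iota (action (p x) a).
Proof.
rewrite {1}(decomp x) bracketDl -lie_morphM (abelian_ext_ker E) linear0 add0r.
by rewrite incl_action.
Qed.

Lemma action_linear : linear action.
Proof.
move=> k b c; apply: lieEnd_ext => a; apply: iota_inj.
rewrite lieEndDE lieEndZE linearP /= !incl_action linearP /=.
by rewrite bracketDl bracketZl.
Qed.

Lemma action_morph : {morph action : b c / {[b, c]}}.
Proof.
move=> b c; apply: lieEnd_ext => a; apply: iota_inj.
rewrite lieEnd_bracketE linearB /= !incl_action -bracketA.
by rewrite [RHS]bracket_incl lie_morphM !psK incl_action.
Qed.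

HB.instance Definition _ :=
  GRing.isLinear.Build F B (lieEnd A) *:%R action action_linear.
HB.instance Definition _ := isLieMorphism.Build F B (lieEnd A) action action_morph.

Definition alpha : {lie B -> lieEnd A} := action.

Lemma incl_alpha b a : iota (alpha b a) = {[s b, iota a]}.
Proof. exact: incl_action. Qed.

Lemma bracket_alpha x a : {[x, iota a]} = iota (alpha (p x) a).
Proof. exact: bracket_incl. Qed.

Definition mu b1 b2 : A := ext_pre E ({[s b1, s b2]} - s {[b1, b2]}).

Lemma incl_mu b1 b2 : iota (mu b1 b2) = {[s b1, s b2]} - s {[b1, b2]}.
Proof. by rewrite ext_preK // linearB /= lie_morphM !psK subrr. Qed.

Lemma mu_cocycle : mu \in cocycle2 alpha.
Proof.
apply/asboolP; split; first split.
- move=> y k x z; apply: iota_inj; rewrite linearP /= !incl_mu.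
  rewrite bracketDl bracketZl !linearP /= bracketDl bracketZl scalerBr.
  by rewrite ?scalerN addrACA.
- move=> y k x z; apply: iota_inj; rewrite linearP /= !incl_mu.
  rewrite bracketDr bracketZr !linearP /= bracketDr bracketZr scalerBr.
  by rewrite ?scalerN addrACA.
- by move=> x; apply: iota_inj; rewrite incl_mu !bracketxx !linear0 addr0.
- move=> x y z; apply: iota_inj; rewrite linear0 /d2.
  rewrite !(raddfD iota, raddfN iota) /= !incl_alpha !incl_mu !bracketBr.
  rewrite [{[s x, {[s y, s z]}]}]bracket_jacobir [in s {[{[x, y]}, z]}]bracket_jacobil.
  rewrite (raddfB s) /= [{[s {[x, y]}, _]}]bracketC [{[s {[x, z]}, _]}]bracketC.
  rewrite [{[s {[y, z]}, _]}]bracketC !opprD !opprK !addrA.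
  rewrite [LHS](ACl ((1 * 4) * (6 * 2) * (13 * 3) * (5 * 11) * (8 * 7) * (9 * 12)
    * (14 * 10)))%AC.
  by rewrite /= !subrr !addr0.
Qed.

Definition preserves_kernel : {pred lieAut L} :=
  fun g : lieAut L => `[< g @` range iota = range iota >].

Lemma preserves_kernelP (g : lieAut L) :
  reflect (g @` range iota = range iota) (g \in preserves_kernel).
Proof. exact: asboolP. Qed.

Lemma preserves_kernel_closed : group_closed preserves_kernel.
Proof.
split=> [|g h /preserves_kernelP gA /preserves_kernelP hA];
  apply/preserves_kernelP; first by rewrite image_id.
have hV : (h^-1)%g @` range iota = range iota.
  rewrite -[in LHS]hA (image_comp h (h^-1)%g).
  by rewrite -[RHS]image_id; apply: eq_imagel => x _; exact: lieAutK.
by rewrite -[in RHS]gA -[in RHS]hV (image_comp (h^-1)%g g).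
Qed.

Record autA := AutA { autA_val :> lieAut L; _ : autA_val \in preserves_kernel }.
HB.instance Definition _ := [isSub for autA_val].
HB.instance Definition _ := [Choice of autA by <:].
HB.instance Definition _ :=
  SubChoice_isSubGroup.Build _ _ autA preserves_kernel_closed.

Lemma autAP (g : autA) : g @` range iota = range iota.
Proof. by case: g => g /= /preserves_kernelP. Qed.

Lemma autAME (g h : autA) x : (g * h)%g x = g (h x). Proof. by []. Qed.
Lemma autA1E x : (1%g : autA) x = x. Proof. by []. Qed.
Lemma autA_ext (g h : autA) : (forall x, g x = h x) -> g = h.
Proof. by move=> gh; apply/val_inj/lieAut_ext. Qed.

Definition compatible : {pred lieAut A * lieAut B} := fun c : lieAut A * lieAut B =>
  `[< forall b, (alpha (c.2 b) : A -> A) = c.1 \o alpha b \o (c.1^-1)%g >].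

Lemma compatibleP (c : lieAut A * lieAut B) :
  reflect (forall b, (alpha (c.2 b) : A -> A) = c.1 \o alpha b \o (c.1^-1)%g)
    (c \in compatible).
Proof. exact: asboolP. Qed.

Lemma compatible_pointwise (c : lieAut A * lieAut B) :
  c \in compatible <-> forall b a, c.1 (alpha b a) = alpha (c.2 b) (c.1 a).
Proof.
split=> [/compatibleP cP b a|cP].
  by rewrite cP; congr (c.1 (alpha b _)); apply/esym/lieAutK.
by apply/compatibleP => b; apply/funext => a; rewrite [RHS]cP; congr (alpha _ _);
  apply/esym/lieAutVK.
Qed.

Lemma compatible_closed : group_closed compatible.
Proof.
split=> [|c d /compatible_pointwise cP /compatible_pointwise dP];
  apply/compatible_pointwise => // b a.
rewrite -[b](lieAutVK d.2) -[a](lieAutVK d.1).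
move: ((d.2^-1)%g b) ((d.1^-1)%g a) => {}b {}a.
change (c.1 ((d.1^-1)%g (alpha (d.2 b) (d.1 a)))
  = alpha (c.2 ((d.2^-1)%g (d.2 b))) (c.1 ((d.1^-1)%g (d.1 a)))).
by rewrite -dP !lieAutK cP.
Qed.

Record Calpha := MkCalpha {
  Calpha_val :> lieAut A * lieAut B; _ : Calpha_val \in compatible }.
HB.instance Definition _ := [isSub for Calpha_val].
HB.instance Definition _ := [Choice of Calpha by <:].
HB.instance Definition _ :=
  SubChoice_isSubGroup.Build _ _ Calpha compatible_closed.

Lemma CalphaP (c : Calpha) b a : c.1 (alpha b a) = alpha (c.2 b) (c.1 a).
Proof.
by case: c => c /= /compatible_pointwise cP; apply: cP.
Qed.

Section Gamma.
Variable l : Z1 alpha.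

Definition gamma (x : L) : L :=
  let b := p x in let a := ext_pre E (x - s b) in
  iota a + iota (l b) + s b.

Lemma gammaE x : gamma x = x + iota (l (p x)).
Proof. by rewrite /gamma addrAC -decomp. Qed.

Lemma gamma_section a b : gamma (iota a + s b) = iota a + iota (l b) + s b.
Proof. by rewrite gammaE linearD /= ext_proj_incl add0r psK addrAC. Qed.

End Gamma.

Lemma gammaNK l : cancel (gamma l) (gamma (- l)).
Proof.
move=> x; rewrite [LHS]gammaE Z1NE gammaE !(raddfD p, raddfN iota) /=.
by rewrite ext_proj_incl addr0 addrK.
Qed.

Lemma gamma_is_lieAut l : `[< is_lieAut (gamma l) >].
Proof.
apply/asboolP; split.
- move=> k x y; rewrite !gammaE !linearP /= scalerDr addrACA //.
- move=> x y; rewrite !gammaE lie_morphM (proj2 (Z1P l)).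
  rewrite bracketDl !bracketDr -lie_morphM (abelian_ext_ker E) linear0 addr0.
  rewrite bracket_alpha [{[iota _, y]}]bracketC bracket_alpha linearB /=.
  by rewrite addrA.
- exists (gamma (- l)); first exact: gammaNK.
  by rewrite -{2}[l]opprK; apply: gammaNK.
Qed.

Definition gammaAut l : lieAut L := LieAut (gamma_is_lieAut l).

Lemma gamma_incl l a : gamma l (iota a) = iota a.
Proof. by rewrite gammaE ext_proj_incl linear0 linear0 addr0. Qed.

Lemma gamma_preserves l : gammaAut l \in preserves_kernel.
Proof.
apply/preserves_kernelP; rewrite -[RHS]image_id; apply: eq_imagel.
by move=> _ [a _ <-]; rewrite /= gamma_incl.
Qed.

Definition i_map (l : Z1 alpha) : autA := AutA (gamma_preserves l).

Section Tau.
Variable g : autA.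

Definition restr (a : A) : A := ext_pre E (g (iota a)).
Definition induced (b : B) : B := p (g (s b)).

Lemma incl_restr a : iota (restr a) = g (iota a).
Proof.
apply: ext_preK.
suff : range iota (g (iota a)) by rewrite ext_exact.
by rewrite -(autAP g); exists (iota a) => //; exists a.
Qed.

Lemma induced_proj x : induced (p x) = p (g x).
Proof.
rewrite /induced [in RHS](decomp x) !linearD /= -incl_restr ext_proj_incl.
by rewrite add0r.
Qed.

End Tau.

Lemma restrK (g h : autA) : cancel g h -> cancel (restr g) (restr h).
Proof. by move=> gK a; apply: iota_inj; rewrite !incl_restr gK. Qed.

Lemma inducedK (g h : autA) : cancel g h -> cancel (induced g) (induced h).
Proof. by move=> gK b; rewrite -[b]psK !induced_proj gK. Qed.

Lemma restr_is_lieAut g : `[< is_lieAut (restr g) >].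
Proof.
apply/asboolP; split.
- move=> k x y; apply: iota_inj.
  by rewrite incl_restr !linearP /= !incl_restr.
- by move=> x y; apply: iota_inj; rewrite incl_restr !lie_morphM !incl_restr.
- exists (restr (g^-1)%g); apply: restrK => x.
    by rewrite -[RHS](autA1E x) -(mulVg g).
  by rewrite -[RHS](autA1E x) -(mulgV g).
Qed.

Lemma induced_is_lieAut g : `[< is_lieAut (induced g) >].
Proof.
apply/asboolP; split.
- by move=> k x y; rewrite /induced !linearP.
- by move=> x y; rewrite -[x]psK -[y]psK -lie_morphM !induced_proj !lie_morphM.
- exists (induced (g^-1)%g); apply: inducedK => x.
    by rewrite -[RHS](autA1E x) -(mulVg g).
  by rewrite -[RHS](autA1E x) -(mulgV g).
Qed.

Definition tau_pair g : lieAut A * lieAut B :=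
  (LieAut (restr_is_lieAut g), LieAut (induced_is_lieAut g)).

Lemma tau_compatible g : tau_pair g \in compatible.
Proof.
apply/compatible_pointwise => b a; apply: iota_inj.
rewrite [LHS]incl_restr !incl_alpha lie_morphM /= -(incl_restr g).
by rewrite !bracket_alpha -induced_proj !psK.
Qed.

Definition tau g : Calpha := MkCalpha (tau_compatible g).

Definition mu_twist (c : Calpha) (b1 b2 : B) : A :=
  c.1 (mu ((c.2^-1)%g b1) ((c.2^-1)%g b2)) - mu b1 b2.

Lemma mu_twist_cocycle c : mu_twist c \in cocycle2 alpha.
Proof.
pose f (b1 b2 : B) : A := c.1 (mu ((c.2^-1)%g b1) ((c.2^-1)%g b2)).
suff fc : f \in cocycle2 alpha by exact: (rpredB fc mu_cocycle).
have /asboolP[[ml mr mx] mc] := mu_cocycle.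
apply/asboolP; split; first split.
- by move=> y k x z; rewrite /f linearP ml linearP.
- by move=> y k x z; rewrite /f linearP mr linearP.
- by move=> x; rewrite /f mx linear0.
move=> x y z; rewrite /d2 /f.
rewrite -[x](lieAutVK c.2) -[y](lieAutVK c.2) -[z](lieAutVK c.2).
move: ((_ : lieAut B) x) ((_ : lieAut B) y) ((_ : lieAut B) z) => {}x {}y {}z.
rewrite -!CalphaP -!lie_morphM !lieAutK -!(raddfB c.1, raddfD c.1) /=.
by have := mc x y z; rewrite /d2 => ->; rewrite linear0.
Qed.

Definition omega (c : Calpha) : H2 alpha :=
  class2 (MkZ2 (mu_twist_cocycle c)).

End AbelianExtension.

Arguments i_map {F A L B E} s l.
Arguments omega {F A L B E} s c.

(* Statements quantified over the sections of an extension are not vacuous. *)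
Lemma lin_section_exists (F : fieldType) (A L B : lieAlgType F)
  (E : extension A L B) : inhabited (lin_section E).
Proof.
pose p := ext_proj E.
pose P (W : set L) := (forall k x y, W x -> W y -> W (k *: x + y)) /\
  (forall x, W x -> p x = 0 -> x = 0).
have [|W [[WD Wp] Wmax]] := @Zorn_bigcup L P.
  move=> G GP Gtot; split=> [k x y [U GU Ux] [V GV Vy]|x [U GU Ux]].
    have [UV|VU] := Gtot _ _ GU GV.
      by exists V => //; apply: (GP _ GV).1 => //; apply: UV.
    by exists U => //; apply: (GP _ GU).1 => //; apply: VU.
  exact: (GP _ GU).2.
have W0 : W 0.
  apply: contrapT => nW0; apply: (Wmax [set 0]).
    split=> [x Wx|/(_ 0 erefl)//]; exfalso; apply: nW0.
    by rewrite -[0](addNr x) -scaleN1r; apply: WD.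
  by split=> [k x y -> ->|x -> //]; rewrite /= scaler0 addr0.
have Winj x y : W x -> W y -> p x = p y -> x = y.
  move=> Wx Wy pxy; apply/eqP; rewrite -subr_eq0 addrC -scaleN1r; apply/eqP.
  by apply: Wp; [apply: WD|rewrite linearP /= pxy scaleN1r addNr].
have Wsurj b : exists x, W x /\ p x = b.
  apply: contrapT => nb; have [x px] := ext_proj_surj E b.
  apply: (Wmax [set z | exists w k, W w /\ z = w + k *: x]).
    split=> [w Ww|]; first by exists w, 0; rewrite scale0r addr0.
    move=> /(_ x) WWx; apply: nb; exists x; split=> //; apply: WWx.
    by exists 0, 1; rewrite scale1r add0r.
  split=> [k _ _ [w [c [Ww ->]]] [v [d [Wv ->]]]|_ [w [c [Ww ->]]]].
    exists (k *: w + v), (k * c + d); split; first exact: WD.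
    by rewrite scalerDr scalerDl scalerA addrACA.
  move=> e; have {}e : p w + c *: b = 0 by rewrite -e linearD linearZ /= px.
  have [c0|c0] := eqVneq c 0.
    by move: e; rewrite c0 !scale0r !addr0; apply: Wp.
  exfalso; apply: nb; exists (- c^-1 *: w + 0); split; first exact: WD.
  have {}e : p w = - (c *: b) by apply/eqP; rewrite -addr_eq0 e.
  rewrite addr0 linearZ /= -[ext_proj E w]/(p w) e.
  by rewrite scaleNr scalerN opprK scalerA mulVf // scale1r.
pose s b : L := sval (cid (Wsurj b)).
have sW b : W (s b) by rewrite /s; case: cid => z [].
have sK : cancel s p by move=> b; rewrite /s; case: cid => z [].
have s_lin : linear s.
  move=> k b c; apply: Winj => //; first exact: WD.
  by rewrite linearP /= !sK.
pose s_linear := GRing.isLinear.Build F B L *:%R s s_lin.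
pose s' : {linear B -> L} := HB.pack s s_linear.
by constructor; apply: (@LinSection _ _ _ _ E s').
Qed.

(* Main.v *)
(* Through the section, [L] is [A + B] as a vector space, with bracket
   [(a, b), (a', b') |-> (b a' - b' a + mu b b', {[b, b']})].  An automorphism
   preserving [A] and inducing [(theta, phi)] has the form
   [(a, b) |-> (theta a + m b, phi b)]; for a compatible pair, such a map
   respects the bracket exactly when [theta (mu b c) - mu (phi b) (phi c)] is
   [d1 (m \o phi^-1)] at [(phi b, phi c)].  For [theta = 1] and [phi = 1] this
   says that [m] is a 1-cocycle; in general it says that [m \o phi^-1] exhibits
   [mu_twist] as a coboundary. *)
From HB Require Import structures.
Require Import Defs.
From mathcomp Require Import all_boot ssralg.
From mathcomp Require Import boolp classical_sets.

Import GRing.Theory.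
Local Open Scope classical_set_scope.
Local Open Scope ring_scope.

Section Exactness.
Context {F : fieldType} {A L B : lieAlgType F}.
Context {E : abelian_extension A L B} (s : lin_section E).
Local Notation iota := (ext_incl E).
Local Notation p := (ext_proj E).

Let iota_inj : injective iota := @ext_incl_inj _ _ _ _ E.
Let psK : cancel s p := lin_sectionK s.

Definition incl_section (a : A) (b : B) : L := iota a + s b.

(** The A-coordinate; together with [p] it inverts [incl_section]. *)
Definition kernel_part (x : L) : A := ext_pre E (x - s (p x)).

Lemma incl_sectionK x : incl_section (kernel_part x) (p x) = x.
Proof. exact/esym/decomp. Qed.

Lemma proj_incl_section a b : p (incl_section a b) = b.
Proof. by rewrite linearD /= ext_proj_incl add0r psK. Qed.

Lemma kernel_part_incl_section a b : kernel_part (incl_section a b) = a.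
Proof. by rewrite /kernel_part proj_incl_section addrK ext_inclK. Qed.

Lemma incl_section0 a : incl_section a 0 = iota a.
Proof. by rewrite /incl_section linear0 addr0. Qed.

Lemma incl_section_inj a b a' b' :
  incl_section a b = incl_section a' b' -> a = a' /\ b = b'.
Proof.
by move=> e; rewrite -[a](kernel_part_incl_section _ b)
  -[b in _ /\ b = _](proj_incl_section a) e kernel_part_incl_section
  proj_incl_section.
Qed.

Lemma incl_sectionP k a b a' b' :
  incl_section (k *: a + a') (k *: b + b')
  = k *: incl_section a b + incl_section a' b'.
Proof. by rewrite /incl_section !linearP /= scalerDr addrACA. Qed.

Lemma kernel_part_linear : linear kernel_part.
Proof.
move=> k x y; rewrite -{1}[x]incl_sectionK -{1}[y]incl_sectionK -incl_sectionP.
exact: kernel_part_incl_section.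
Qed.

HB.instance Definition _ :=
  GRing.isLinear.Build F L A *:%R kernel_part kernel_part_linear.

(** Since [A] is abelian, the bracket of the two A-parts vanishes; the mixed brackets give the
    action, and [{[s b, s b']}] splits into [mu s b b'] and [s {[b, b']}]. *)
Lemma bracket_incl_section a b a' b' :
  {[incl_section a b, incl_section a' b']}
  = incl_section (alpha s b a' - alpha s b' a + mu s b b') {[b, b']}.
Proof.
rewrite /incl_section bracketDl !bracketDr -lie_morphM (abelian_ext_ker E).
rewrite linear0 add0r [{[iota a, _]}]bracketC -!incl_alpha.
rewrite !(raddfD iota, raddfN iota) /= incl_mu -!addrA addNr addr0.
by rewrite addrCA.
Qed.

(** The map [m] of the overview: it measures how far [g] is from carrying [s b] to the section value
    over the induced image of [b]. *)
Definition defect (g : autA E) (b : B) : A := kernel_part (g (s b)).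

Lemma defect_linear (g : autA E) : linear (defect g).
Proof. by move=> k b c; rewrite /defect !linearP. Qed.

HB.instance Definition _ g :=
  GRing.isLinear.Build F B A *:%R (defect g) (defect_linear g).

Lemma autA_incl_section (g : autA E) a b :
  g (incl_section a b)
  = incl_section ((tau s g).1 a + defect g b) ((tau s g).2 b).
Proof.
rewrite linearD /= -incl_restr -[g (s b)]incl_sectionK.
by rewrite /incl_section linearD addrA.
Qed.

(** Expand [g {[s b, s c]}] before and after moving [g] inside the bracket, and compare
    A-coordinates. *)
Lemma defect_bracket (g : autA E) b c :
  (tau s g).1 (mu s b c) + defect g {[b, c]}
  = alpha s ((tau s g).2 b) (defect g c)
    - alpha s ((tau s g).2 c) (defect g b)
    + mu s ((tau s g).2 b) ((tau s g).2 c).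
Proof.
have : g {[incl_section 0 b, incl_section 0 c]}
  = {[g (incl_section 0 b), g (incl_section 0 c)]} by exact: lie_morphM.
rewrite bracket_incl_section !linear0 !add0r !autA_incl_section.
by rewrite bracket_incl_section !linear0 !add0r => /incl_section_inj[].
Qed.

Lemma mu_twist_aut (c : Calpha s) b b' :
  mu_twist c (c.2 b) (c.2 b') = c.1 (mu s b b') - mu s (c.2 b) (c.2 b').
Proof. by rewrite /mu_twist !lieAutK. Qed.

Lemma Calpha_ext (c d : Calpha s) : c.1 =1 d.1 -> c.2 =1 d.2 -> c = d.
Proof.
move=> e1 e2; apply: val_inj; rewrite /= [LHS]surjective_pairing.
by rewrite [RHS]surjective_pairing; congr pair; exact: lieAut_ext.
Qed.

Lemma omega_eq0 (c : Calpha s) :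
  omega s c = 0 <-> exists l : {linear B -> A}, mu_twist c = d1 (alpha s) l.
Proof. by rewrite class2_eq0; split=> [/asboolP|?]; last exact/asboolP. Qed.

Lemma tauM : {morph tau s : g h / (g * h)%g}.
Proof.
move=> g h; apply: Calpha_ext => [a|b].
  by apply: iota_inj; rewrite [LHS]incl_restr [RHS]incl_restr incl_restr.
(* [h (s b)] need not lie in the image of [s], so multiplicativity rests on [induced_proj]: the
   induced map can be computed from any lift. *)
rewrite -[b]psK [LHS]induced_proj.
transitivity (induced s g (induced s h (p (s b)))); last by [].
by rewrite !induced_proj.
Qed.

(** Each [gamma] shifts a point inside its fibre over [B] by an amount depending only on that fibre,
    so composing adds the shifts. *)
Lemma i_mapD : {morph i_map s : l m / l + m >-> (l * m)%g}.
Proof.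
move=> l m; apply: autA_ext => x; rewrite autAME /= !gammaE Z1DE !linearD /=.
by rewrite ext_proj_incl !linear0 addr0 -addrA [iota (m _) + _]addrC.
Qed.

Lemma i_map_inj : injective (i_map s).
Proof.
move=> l m e; apply: Z1_ext => b; apply: iota_inj; apply: (addrI (s b)).
have /= := congr1 (fun g : autA E => g (s b)) e.
by rewrite !gammaE psK.
Qed.

Lemma tau_i_map l : tau s (i_map s l) = 1%g.
Proof.
apply: Calpha_ext => [a|b].
  by apply: iota_inj; rewrite [LHS]incl_restr /= gamma_incl.
by rewrite -[b]psK [LHS]induced_proj /= gammaE linearD /= ext_proj_incl addr0.
Qed.

Lemma tau_eq1_i_map (g : autA E) : tau s g = 1%g -> exists l, i_map s l = g.
Proof.
move=> g1; have lc : defect g \in cocycle1 (alpha s).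
  apply/asboolP; split=> [|b c]; first exact: linearP.
  (* For the trivial pair both sides contain [mu s b c]; cancelling it leaves the cocycle
     identity. *)
  have := defect_bracket g b c; rewrite g1 /= [RHS]addrC.
  exact: addrI.
exists (MkZ1 lc); apply: autA_ext => x /=.
rewrite -[x in RHS]incl_sectionK autA_incl_section g1 gammaE /=.
rewrite -[x in LHS]incl_sectionK proj_incl_section.
by rewrite /incl_section linearD addrAC.
Qed.

Lemma omega_tau (g : autA E) : omega s (tau s g) = 0.
Proof.
apply/omega_eq0; pose m : {linear B -> A} := defect g \o ((tau s g).2^-1)%g.
have mE b : m ((tau s g).2 b) = defect g b.
  by rewrite /m /=; congr (defect g _); exact: (lieAutK (tau s g).2).
exists m; apply/funext => b; apply/funext => c.
(* Every element of [B] is a value of the induced automorphism; at such values the inverses in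
   [mu_twist] and [m] disappear and [defect_bracket] applies. *)
rewrite -[b](lieAutVK (tau s g).2) -[c](lieAutVK (tau s g).2).
move: (((tau s g).2^-1)%g b) (((tau s g).2^-1)%g c) => {}b {}c.
rewrite mu_twist_aut /d1 -lie_morphM !mE.
by apply/eqP; rewrite subr_eq addrAC -defect_bracket addrK.
Qed.

Section Lift.
Variables (c : Calpha s) (l : {linear B -> A}).
Hypothesis mu_twist_d1 : mu_twist c = d1 (alpha s) l.

(** The form given in the overview with [m] equal to [l \o c.2], so that [m \o phi^-1] is the given
    [l]. *)
Definition lift_fun (x : L) : L :=
  incl_section (c.1 (kernel_part x) + l (c.2 (p x))) (c.2 (p x)).

Lemma lift_fun_incl_section a b :
  lift_fun (incl_section a b) = incl_section (c.1 a + l (c.2 b)) (c.2 b).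
Proof. by rewrite /lift_fun kernel_part_incl_section proj_incl_section. Qed.

Lemma lift_fun_incl a : lift_fun (iota a) = iota (c.1 a).
Proof.
by rewrite -incl_section0 lift_fun_incl_section !linear0 addr0 incl_section0.
Qed.

Lemma lift_fun_linear : linear lift_fun.
Proof.
move=> k x y; rewrite /lift_fun -incl_sectionP !linearP /=.
by rewrite scalerDr addrACA.
Qed.

Lemma lift_fun_bracket : {morph lift_fun : x y / {[x, y]}}.
Proof.
move=> x y; rewrite -[x]incl_sectionK -[y]incl_sectionK.
move: (kernel_part x) (p x) (kernel_part y) (p y) => a b a' b'.
rewrite bracket_incl_section !lift_fun_incl_section bracket_incl_section.
rewrite lie_morphM; congr incl_section.
(* The B-coordinates agree already. In the A-coordinate, compatibility handles the action terms, and
   the coboundary hypothesis rewrites [c.1 (mu s b b')]. *)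
have := mu_twist_aut c b b'; rewrite mu_twist_d1 /d1 => /eqP.
rewrite eq_sym subr_eq => /eqP mub.
rewrite (raddfD (alpha s (c.2 b))) (raddfD (alpha s (c.2 b'))).
have -> u v w : c.1 (u - v + w) = c.1 u - c.1 v + c.1 w.
  by rewrite linearD linearB.
rewrite mub !CalphaP opprD !addrA.
(* Terms 5 and 7 are [l] of the bracket of [c.2 b] and [c.2 b'], with opposite signs. *)
by rewrite [LHS](ACl (1 * 3 * 2 * 4 * 6 * (5 * 7)))%AC /= addNr addr0.
Qed.

Lemma lift_fun_bij : bijective lift_fun.
Proof.
(* The shift [l (c.2 b)] depends only on the B-coordinate of the image, so it can be subtracted
   before inverting [c.1] and [c.2]. *)
exists (fun y => incl_section ((c.1^-1)%g (kernel_part y - l (p y)))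
  ((c.2^-1)%g (p y))) => x.
- rewrite {1 2 3}/lift_fun !kernel_part_incl_section !proj_incl_section.
  by rewrite addrK !lieAutK incl_sectionK.
- by rewrite lift_fun_incl_section !lieAutVK subrK incl_sectionK.
Qed.

Lemma lift_fun_is_lieAut : `[< is_lieAut lift_fun >].
Proof.
apply/asboolP; split; [exact: lift_fun_linear|exact: lift_fun_bracket|].
exact: lift_fun_bij.
Qed.

Definition lift_aut : lieAut L := LieAut lift_fun_is_lieAut.

Lemma lift_aut_preserves : lift_aut \in preserves_kernel E.
Proof.
apply/preserves_kernelP/seteqP; split=> [_ [_ [a _ <-] <-]|_ [a _ <-]].
  by exists (c.1 a) => //; rewrite /= lift_fun_incl.
exists (iota ((c.1^-1)%g a)); first by exists ((c.1^-1)%g a).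
by rewrite /= lift_fun_incl lieAutVK.
Qed.

Definition lift : autA E := AutA lift_aut_preserves.

Lemma tau_lift : tau s lift = c.
Proof.
apply: Calpha_ext => [a|b].
  by apply: iota_inj; rewrite [LHS]incl_restr /= lift_fun_incl.
by rewrite -[b]psK [LHS]induced_proj /= proj_incl_section.
Qed.

End Lift.

End Exactness.

Theorem theorem1p2 (F : fieldType) (A L B : lieAlgType F)
    (E : abelian_extension A L B) (s : lin_section E) :
  [/\ {morph i_map s : x y / x + y >-> (x * y)%g},
      {morph tau s : x y / (x * y)%g},
      injective (i_map s),
      range (i_map s) = [set g | tau s g = 1%g] &
      range (tau s) = [set c | omega s c = 0]].
Proof.
split; [exact: i_mapD|exact: tauM|exact: i_map_inj| |].
- apply/seteqP; split=> [_ [l _ <-]|g /tau_eq1_i_map[l <-]].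
    exact: tau_i_map.
  by exists l.
- apply/seteqP; split=> [_ [g _ <-]|c /omega_eq0[l cl]]; first exact: omega_tau.
  by exists (lift s c l cl); rewrite ?tau_lift.
Qed.
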